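(* Let $n\ge 2$ and suppose the players' values satisfy $v_1 > v = v_2 = v_3 = \cdots = v_n > 0$. Write $n = 2^s + k$ with integers $s\ge 1$ and $0\le k<2^s$. Then the balanced format, which schedules $k$ matches in round $1$ and then has all remaining players competing in each subsequent round, attains the maximal possible value of $P_1$ among all formats for $n$ players.
   Context: Random knockout tournament: there are $n\ge 2$ players $1,\dots,n$ with positive values $v_1,\dots,v_n$. A format is a tuple $(r,m_1,\dots,m_r)$ of positive integers with $\sum_{s=1}^r m_s = n-1$ and $2m_s \le r_s$ for each $s$, where $r_s = n-\sum_{j=1}^{s-1} m_j$ is the number of players still alive (not eliminated) at the start of round $s$. In round $s$, independently of the past given the set of alive players, $2m_s$ of the $r_s$ alive players are chosen uniformly at random and are uniformly randomly arranged into $m_s$ match pairs. A match between $i$ and $j$ is won by $i$ with probability $v_i/(v_i+v_j)$, independently of everything else. Losers are eliminated; the winners and the alive players not chosen to play advance to the next round. After round $r$ exactly one player remains, the winner of the tournament. $P_i$ denotes the probability that player $i$ wins the tournament (it depends on the format). For $n=2^s+k$ with $0\le k<2^s$, the balanced format has $k$ matches in the first round and then matches numbering $2^{s-1},2^{s-2},\dots,1$ in the subsequent rounds; when $k=0$ the empty first round is omitted, so that the match numbers are $2^{s-1},2^{s-2},\dots,1$. *)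

(* Defs.v *)
From HB Require Import structures.
From mathcomp Require Import all_boot all_order all_algebra.

Set Implicit Arguments.
Unset Strict Implicit.
Unset Printing Implicit Defensive.

Import Order.TTheory GRing.Theory Num.Theory.
Local Open Scope ring_scope.

(* A format (r, m_1, ..., m_r) is the sequence of its match numbers; its entry
   of index s (counted from 0) is played by n - sumn (take s f) players. *)
Definition is_format (n : nat) (f : seq nat) : Prop :=
  [/\ forall s, (s < size f)%N -> (0 < nth 0 f s)%N,
      sumn f = (n - 1)%N
    & forall s, (s < size f)%N -> (2 * nth 0 f s <= n - sumn (take s f))%N].

Definition balanced (s k : nat) : seq nat :=
  (if k == 0%N then [::] else [:: k]) ++ rev [seq (2 ^ i)%N | i <- iota 0 s].

Definition draws (T : finType) (A : {set T}) (d : nat) : {set {set T}} :=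
  [set S : {set T} | S \subset A & #|S| == d].

Definition pairings (T : finType) (S : {set T}) : {set {set {set T}}} :=
  [set M : {set {set T}} | partition M S & [forall B in M, #|B| == 2%N]].

(* Probability that W is the set of winners of the matches of M; the inner
   product has a single factor, for the opponent j of i. *)
Definition winners_prob (R : realFieldType) (T : finType) (v : T -> R)
    (M : {set {set T}}) (W : {set T}) : R :=
  \prod_(i in W) \prod_(j in pblock M i :\ i) (v i / (v i + v j)).

(* Probability that a round of m matches between alive players of A leaves
   exactly B alive: S is the uniformly drawn set of 2m players, M its uniform
   arrangement into matches, and W the set of winners, which contains one
   player from each match. *)
Definition round_prob (R : realFieldType) (T : finType) (v : T -> R)
    (m : nat) (A B : {set T}) : R :=
  \sum_(S in draws A (2 * m)%N) (#|draws A (2 * m)%N|%:R)^-1 *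
    \sum_(M in pairings S) (#|pairings S|%:R)^-1 *
      \sum_(W : {set T} | is_transversal W M S && ((A :\: S) :|: W == B))
        winners_prob v M W.

(* The set of alive players is a Markov chain, so the transition probabilities
   of successive rounds compose. *)
Fixpoint alive_prob (R : realFieldType) (T : finType) (v : T -> R)
    (f : seq nat) (A B : {set T}) : R :=
  if f is m :: f' then
    \sum_(C : {set T}) round_prob v m A C * alive_prob v f' C B
  else (A == B)%:R.

Definition win_prob (R : realFieldType) (n : nat) (v : 'I_n -> R)
    (f : seq nat) (i : 'I_n) : R :=
  alive_prob v f [set: 'I_n] [set i].

(* Players are numbered from 0, so player 1 has index 0. *)
Definition player1 (n : nat) (hn : (2 <= n)%N) : 'I_n := Ordinal (ltnW hn).

(* Main.v *)
Require Import Defs.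
From HB Require Import structures.
From mathcomp Require Import all_boot all_order all_algebra.
From mathcomp Require Import ring lra zify.

Set Implicit Arguments.
Unset Strict Implicit.
Unset Printing Implicit Defensive.

Import Order.TTheory GRing.Theory Num.Theory.
Local Open Scope ring_scope.

(** The strong player, called the champion below, meets opponents who all have
    the same value w, so the only thing that matters about the opponents is how
    many of them are left.  With p = v x / (v x + w) the champion's chance in a
    match, he takes part in a round of m matches among r players with
    probability 2m/r, whoever is alive, and survives the round with probability
    1 - (2m/r)(1 - p) = 1 - c m / r, where c = 2 w / (v x + w).  Hence P_1 is
    the product [survival] of these factors over the rounds
    ([alive_prob_survival]).

    The probabilistic part is [round_survival].  For a fixed arrangement M into
    pairs, the sum over all sets of winners of the product of their win
    factors is the product over the pairs of the sums inside each pair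
    ([sum_transversals]).  Each pair contributes 1, and restricting to the sets
    of winners that contain the champion changes the factor of his pair to p.
    The result does not depend on M, so averaging over M is trivial, and
    averaging over the drawn players uses the fraction 2m/r of the draws
    that contain the champion ([card_draws_mem]).

    The maximisation is then deterministic.  The balanced format for 2^s + k
    players has the value (1 - c/2)^s (1 - c k / (2^s + k)).  By induction on
    the format ([survival_le_balanced]) it is enough that no first round
    followed by a balanced format beats the balanced format.  Since 2m <= n,
    the number of remaining players lies between 2^s and 2^(s+1), or between
    2^(s-1) and 2^s; in the two cases the gain of the balanced format is an
    explicit fraction containing the factor c (1 - c) and otherwise nonnegative
    factors ([round_same_level], [round_next_level]).  That the
    champion is stronger than the others enters as c <= 1. *)

(** * Winners of a set of pairs *)

(** This is distributivity: a transversal is the same thing as a choice of one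
    element in each block.  The default x0 is only there to represent choices
    as finite functions defined on all sets. *)
Lemma sum_transversals (R : comNzRingType) (T : finType) (x0 : T)
    (P : {set {set T}}) (D : {set T}) (F : T -> R) :
  partition P D ->
  \sum_(W | is_transversal W P D) \prod_(i in W) F i
    = \prod_(B in P) \sum_(i in B) F i.
Proof.
move=> partP; have trivP := partition_trivIset partP.
rewrite (big_distr_big_dep x0).
pose image_of (f : {ffun {set T} -> T}) := [set f B | B in P].
pose choice_of W : {ffun {set T} -> T} :=
  [ffun B => if B \in P then transversal_repr x0 W B else x0].
rewrite (reindex_onto image_of choice_of) /=; last first.
  move=> W trW; rewrite -[RHS](im_transversal_repr trW x0).
  by apply: eq_in_imset => B BP; rewrite ffunE BP.
(* The choice functions, extended by x0 outside P, are exactly those that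
   their image determines through its intersections with the blocks. *)
have pfamE f : (f \in pfamily x0 (mem P) (fun B : {set T} => mem B)) =
    is_transversal (image_of f) P D && (choice_of (image_of f) == f).
  apply/pfamilyP/andP=> [[/supportP f0 fP]|[trf /eqP fE]]; last first.
    split; last by move=> B BP; rewrite -fE ffunE BP (repr_mem_pblock trf).
    by apply/supportP => B BP; rewrite -fE ffunE (negbTE BP).
  have imI B : B \in P -> image_of f :&: B = [set f B].
    move=> BP; apply/setP => y; rewrite !inE.
    apply/andP/eqP=> [[/imsetP[C CP ->] fCB]|->]; last first.
      by rewrite imset_f // fP.
    by rewrite -(def_pblock trivP CP (fP _ CP)) (def_pblock trivP BP fCB).
  split.
    rewrite /is_transversal partP /=; apply/andP; split.
      apply/subsetP => _ /imsetP[B BP ->].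
      by rewrite -(cover_partition partP); apply/bigcupP; exists B => //;
        apply: fP.
    by apply/forall_inP => B BP; rewrite imI // cards1.
  apply/eqP/ffunP => B; rewrite ffunE; case: ifPn => BP; last by rewrite f0.
  rewrite /transversal_repr imI //; case: pickP => [y|/(_ (f B))].
    by rewrite inE => /eqP.
  by rewrite inE eqxx.
apply: eq_big => [f|f /andP[trf /eqP fE]]; first by rewrite pfamE.
rewrite big_imset //= => B C BP CP fBC.
have memf X : X \in P -> f X \in X.
  by move=> XP; rewrite -fE ffunE XP (repr_mem_pblock trf).
by rewrite -(def_pblock trivP BP (memf _ BP)) fBC
  (def_pblock trivP CP (memf _ CP)).
Qed.

Lemma pairingsP (T : finType) (S : {set T}) (M : {set {set T}}) :
  reflect (partition M S /\ {in M, forall B : {set T}, #|B| = 2%N})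
          (M \in pairings S).
Proof.
rewrite inE; apply: (iffP andP) => [[-> /forall_inP h]|[-> h]]; split=> //.
  by move=> B /h/eqP.
by apply/forall_inP => B /h/eqP.
Qed.

(** Makes division by the number of pairings a genuine average. *)
Lemma card_pairings_gt0 (T : finType) (m : nat) (S : {set T}) :
  #|S| = (2 * m)%N -> (0 < #|pairings S|)%N.
Proof.
move=> cS; apply/card_gt0P; elim: m S cS => [|m IHm] S cS.
  exists set0; apply/pairingsP; split; last by move=> B; rewrite inE.
  by rewrite (cards0_eq cS) partition_set0.
have /card_gt0P[a aS] : (0 < #|S|)%N by rewrite cS mulnS.
have := cardsD1 a S; rewrite aS cS => cSa.
have /card_gt0P[b bSa] : (0 < #|S :\ a|)%N by lia.
have := cardsD1 b (S :\ a); rewrite bSa => cSab.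
have [|M /pairingsP[partM M2]] := IHm (S :\ a :\ b); first by lia.
move: bSa; rewrite !inE => /andP[ba bS].
have ab2 : #|[set a; b]| = 2%N by rewrite cards2 eq_sym ba.
exists ([set a; b] |: M); apply/pairingsP; split; last first.
  by move=> B; rewrite !inE => /orP[/eqP->|/M2].
have -> : S = [set a; b] :|: (S :\ a :\ b).
  apply/setP => y; rewrite !inE.
  by case: (eqVneq y a) => [->|_] //=; case: (eqVneq y b) => [->|_].
apply: partitionU1 => //; first by rewrite -card_gt0 ab2.
rewrite disjoints_subset; apply/subsetP => y; rewrite !inE.
by case/orP => ->; rewrite ?andbF.
Qed.

(** * One round of the tournament *)

Section Round.
Variables (R : realFieldType) (T : finType) (v : T -> R).
Hypothesis v_gt0 : forall i, 0 < v i.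

(** Summing against an arbitrary h turns the one-step transition matrix into an
    average over what is drawn, which removes the constraint on the set of
    survivors. *)
Lemma round_prob_expectation (m : nat) (A : {set T}) (h : {set T} -> R) :
  \sum_C round_prob v m A C * h C =
  \sum_(S in draws A (2 * m)%N) (#|draws A (2 * m)%N|%:R)^-1 *
    \sum_(M in pairings S) (#|pairings S|%:R)^-1 *
      \sum_(W | is_transversal W M S) winners_prob v M W * h ((A :\: S) :|: W).
Proof.
under eq_bigr => C _ do rewrite /round_prob mulr_suml.
rewrite exchange_big /=; apply: eq_bigr => S _.
under eq_bigr => C _ do rewrite -mulrA mulr_suml.
rewrite -mulr_sumr exchange_big /=; congr (_ * _); apply: eq_bigr => M _.
under eq_bigr => C _ do rewrite -mulrA mulr_suml.
rewrite -mulr_sumr; congr (_ * _).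
rewrite [RHS](partition_big (fun W => (A :\: S) :|: W) xpredT) //=.
by apply: eq_bigr => C _; apply: eq_bigr => W /andP[_ /eqP ->].
Qed.

Lemma pairing_blockP (S : {set T}) (M : {set {set T}}) (B : {set T}) :
    M \in pairings S -> B \in M ->
  exists a b, [/\ a != b, B = [set a; b], pblock M a = B & pblock M b = B].
Proof.
move=> /pairingsP[/partition_trivIset trivM M2] BM.
have /eqP/cards2P[a [b [ab BE]]] := M2 _ BM; exists a, b; split=> //.
  by apply: def_pblock; rewrite // BE set21.
by apply: def_pblock; rewrite // BE set22.
Qed.

Definition win_factor (M : {set {set T}}) (i : T) : R :=
  \prod_(j in pblock M i :\ i) (v i / (v i + v j)).

Lemma win_factor_pair (M : {set {set T}}) (a b : T) :
  a != b -> pblock M a = [set a; b] -> win_factor M a = v a / (v a + v b).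
Proof.
move=> ab E; rewrite /win_factor E.
have -> : [set a; b] :\ a = [set b] by rewrite setU1K // inE.
by rewrite big_set1.
Qed.

Lemma sum_win_factor (S : {set T}) (M : {set {set T}}) (B : {set T}) :
  M \in pairings S -> B \in M -> \sum_(i in B) win_factor M i = 1.
Proof.
move=> MS BM; have [a [b [ab BE Ea Eb]]] := pairing_blockP MS BM.
have fa : win_factor M a = v a / (v a + v b).
  by apply: win_factor_pair; rewrite // Ea.
have fb : win_factor M b = v b / (v b + v a).
  by apply: win_factor_pair; rewrite 1?eq_sym // Eb BE setUC.
rewrite BE big_setU1 ?inE //= big_set1 fa fb [v b + _]addrC -mulrDl divff //.
by rewrite gt_eqF // addr_gt0.
Qed.

Lemma sum_winners_prob (S : {set T}) (M : {set {set T}}) (x0 : T) :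
  M \in pairings S ->
  \sum_(W | is_transversal W M S) winners_prob v M W = 1.
Proof.
move=> MS; have /pairingsP[partM _] := MS.
rewrite (sum_transversals x0 (win_factor M) partM).
by apply: big1 => B; apply: (sum_win_factor MS).
Qed.

Variables (x : T) (w : R).
Hypothesis w_gt0 : 0 < w.
Hypothesis v_others : forall i, i != x -> v i = w.

Lemma win_factor_champion (S : {set T}) (M : {set {set T}}) :
  M \in pairings S -> x \in S -> win_factor M x = v x / (v x + w).
Proof.
move=> MS xS; have /pairingsP[partM _] := MS.
have covM := cover_partition partM.
have xM : pblock M x \in M by rewrite pblock_mem // covM.
have : x \in pblock M x by rewrite mem_pblock covM.
have [a [b [ab E _ _]]] := pairing_blockP MS xM.
rewrite E !inE => /orP[] /eqP xE.
  by rewrite -xE in ab E; rewrite (win_factor_pair ab) //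
    (v_others (i := b)) // eq_sym.
rewrite -xE in ab E; rewrite setUC in E; rewrite eq_sym in ab.
by rewrite (win_factor_pair ab) // (v_others (i := a)) // eq_sym.
Qed.

(** Winning sets that contain x are selected by setting to zero the factor of
    the opponent of x: since a transversal meets the pair of x exactly once,
    this kills the other transversals and leaves these unchanged.  The product
    formula then applies as before. *)
Lemma sum_winners_prob_champion (S : {set T}) (M : {set {set T}}) :
  M \in pairings S -> x \in S ->
  \sum_(W | is_transversal W M S) winners_prob v M W * (x \in W)%:R
    = v x / (v x + w).
Proof.
move=> MS xS; have /pairingsP[partM _] := MS.
have covM := cover_partition partM; have trivM := partition_trivIset partM.
have xM : pblock M x \in M by rewrite pblock_mem // covM.
have xB : x \in pblock M x by rewrite mem_pblock covM.
pose F i := if i \in pblock M x :\ x then 0 else win_factor M i.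
transitivity (\sum_(W | is_transversal W M S) \prod_(i in W) F i).
  apply: eq_bigr => W trW; have /and3P[_ WS /forall_inP trW1] := trW.
  have /cards1P[y Wy] := trW1 _ xM.
  have : y \in W :&: pblock M x by rewrite Wy set11.
  rewrite inE => /andP[yW yB]; case: (eqVneq y x) => yx.
    subst y; rewrite yW mulr1; apply: eq_bigr => i iW; rewrite /F.
    case: ifP => //; rewrite !inE => /andP[ix iB].
    have : i \in W :&: pblock M x by rewrite inE iW.
    by rewrite Wy inE (negbTE ix).
  have -> : x \in W = false.
    apply/negP => xW; have : x \in W :&: pblock M x by rewrite inE xW.
    by rewrite Wy inE eq_sym (negbTE yx).
  by rewrite mulr0 (bigD1 y) //= /F !inE yx yB mul0r.
rewrite (sum_transversals x F partM) (bigD1 (pblock M x)) //=.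
rewrite [X in _ * X]big1 ?mulr1 => [|B /andP[BM Bx]].
  rewrite (bigD1 x) //= big1 ?addr0 => [|i /andP[iB ix]].
    by rewrite /F !inE eqxx /= (win_factor_champion MS xS).
  by rewrite /F !inE ix iB.
rewrite -[RHS](sum_win_factor MS BM); apply: eq_bigr => i iB; rewrite /F.
case: ifP => //; rewrite !inE => /andP[_ iB'].
by case/eqP: Bx; rewrite -(def_pblock trivM BM iB); apply: def_pblock.
Qed.

(** The draws avoiding x are those from the other players, so by the Pascal rule
    those containing x number C(r - 1, d - 1), and r C(r - 1, d - 1) =
    d C(r, d). *)
Lemma card_draws_mem (A : {set T}) (d : nat) : x \in A ->
  (#|A| * #|[set S in draws A d | x \in S]| = d * #|draws A d|)%N.
Proof.
move=> xA; have cA := cardsD1 x A; rewrite xA add1n in cA.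
have cN : #|draws A d :\: [set S : {set T} | x \in S]| = 'C(#|A|.-1, d).
  rewrite cA /= -cards_draws; apply: eq_card => S; rewrite !inE subsetD1.
  by rewrite andbA [(_ \notin _) && _]andbC.
have cD : #|draws A d| = 'C(#|A|, d) by rewrite cards_draws.
have -> : [set S in draws A d | x \in S] =
    draws A d :&: [set S : {set T} | x \in S].
  by apply/setP => S; rewrite !inE.
have := cardsID [set S : {set T} | x \in S] (draws A d); rewrite cN cD.
case: d => [|d] in cN cD *; set I := #|_ :&: _|.
  by rewrite !bin0 => cI; rewrite (_ : I = 0%N) ?muln0 //; lia.
rewrite -mul_bin_diag cA binS /= addnC => /addnI ->.
by [].
Qed.

(** The function h stands for the champion's chances in the rest of the
    tournament, which are known only for sets of the size reached after the
    round; all the sets reached with positive probability have that size. *)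
Lemma round_survival (m : nat) (A : {set T}) (h : {set T} -> R) (g : R) :
    (0 < m)%N -> (2 * m <= #|A|)%N ->
    (forall C : {set T}, #|C| = (#|A| - m)%N -> h C = (x \in C)%:R * g) ->
  \sum_C round_prob v m A C * h C =
  (x \in A)%:R * ((1 - 2 * w / (v x + w) * m%:R / #|A|%:R) * g).
Proof.
move=> m0 mA hE.
pose p := v x / (v x + w).
have r0 : (#|A|%:R : R) != 0 by rewrite pnatr_eq0; lia.
have D0 : (#|draws A (2 * m)|%:R : R) != 0.
  by rewrite pnatr_eq0 -lt0n cards_draws bin_gt0.
have avgM S : S \in draws A (2 * m) ->
  \sum_(M in pairings S) (#|pairings S|%:R)^-1 *
    (\sum_(W | is_transversal W M S) winners_prob v M W * h ((A :\: S) :|: W))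
  = (x \in A)%:R * (1 - (1 - p) * (x \in S)%:R) * g.
  rewrite inE => /andP[SA /eqP cS].
  have N0 : (#|pairings S|%:R : R) != 0.
    by rewrite pnatr_eq0 -lt0n (card_pairings_gt0 cS).
  (* For each arrangement the chance is already 1 - (1 - p) [x in S], so the
     average over arrangements is that of a constant. *)
  have avgW M : M \in pairings S ->
      \sum_(W | is_transversal W M S) winners_prob v M W * h ((A :\: S) :|: W)
      = (x \in A)%:R * (1 - (1 - p) * (x \in S)%:R) * g.
    move=> MS.
    have /pairingsP[partM M2] := MS.
    have cM : #|M| = m.
      by have := card_uniform_partition M2 partM; rewrite cS; lia.
    transitivity (\sum_(W | is_transversal W M S)
        winners_prob v M W * (x \in (A :\: S) :|: W)%:R * g).
      apply: eq_bigr => W trW; rewrite hE ?mulrA //.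
      have WS := transversal_sub trW; have cW := card_transversal trW.
      have -> : #|A :\: S :|: W| = (#|A :\: S| + #|W|)%N.
        apply/eqP; rewrite (leq_card_setU (A :\: S) W).2 disjoint_sym.
        rewrite disjoints_subset; apply: (subset_trans WS).
        by apply/subsetP => i iS; rewrite !inE iS.
      by rewrite cardsDS // cS cW cM; lia.
    rewrite -mulr_suml; congr (_ * _).
    case xS: (x \in S).
      rewrite (subsetP SA) // mul1r mulr1 subKr.
      rewrite -[RHS](sum_winners_prob_champion MS xS).
      by apply: eq_bigr => W _; rewrite !inE xS.
    rewrite mulr0 subr0 mulr1 -[RHS]mul1r -(sum_winners_prob x MS) mulr_suml.
    apply: eq_bigr => W trW; rewrite !inE xS /=.
    have -> : x \in W = false.
      by apply/negP => /(subsetP (transversal_sub trW)); rewrite xS.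
    by rewrite orbF.
  under eq_bigr => M MS do rewrite avgW //.
  by rewrite sumr_const -[LHS]mulr_natl mulVKf.
rewrite round_prob_expectation.
under eq_bigr => S SD do rewrite avgM //.
have [xA|xA] := boolP (x \in A); last first.
  by rewrite !mul0r big1 // => S _; rewrite !mul0r mulr0.
rewrite -mulr_sumr -mulr_suml.
under eq_bigr => S _ do rewrite mul1r.
rewrite sumrB sumr_const -mulr_sumr.
have -> : \sum_(S in draws A (2 * m)) (x \in S)%:R
    = (2 * m)%:R / #|A|%:R * #|draws A (2 * m)|%:R :> R.
  rewrite -mulrAC -natrM -(card_draws_mem _ xA) natrM mulrAC mulfV // mul1r.
  rewrite -sum1_card natr_sum big_mkcond [RHS]big_mkcond.
  by apply: eq_bigr => S _; rewrite inE; case: ifP => //= _; case: ifP.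
have vw0 : v x + w != 0 by rewrite gt_eqF // addr_gt0.
rewrite /p mul1r mulrA (natrM _ 2 m); congr (_ * _).
by field; rewrite vw0 r0 D0.
Qed.

End Round.

(** * From the Markov chain to a product *)

Lemma format_cons n m f : is_format n (m :: f) ->
  [/\ (0 < m)%N, (2 * m <= n)%N & is_format (n - m) f].
Proof.
case=> pos sumE le2; split; [exact: (pos 0%N)| |split].
- by have := le2 0%N isT; rewrite /= subn0.
- by move=> s; apply: (pos s.+1).
- by move: sumE => /=; lia.
- by move=> s /(le2 s.+1) /=; rewrite subnDA.
Qed.

(** The champion's chance of winning with format f among r players, where c
    is twice his chance of losing a match. *)
Fixpoint survival (R : realFieldType) (c : R) (f : seq nat) (r : nat) : R :=
  if f is m :: f' then (1 - c * m%:R / r%:R) * survival c f' (r - m) else 1.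

(** The survival factor of a round depends on the alive set only through its
    size, so it can be pulled out of the transition sums round by round.  A set
    without x never leads to x alone, whence the indicator. *)
Lemma alive_prob_survival (R : realFieldType) (T : finType) (v : T -> R)
    (v_gt0 : forall i, 0 < v i) (x : T) (w : R)
    (w_gt0 : 0 < w) (v_others : forall i, i != x -> v i = w) f (A : {set T}) :
  is_format #|A| f ->
  alive_prob v f A [set x] =
    (x \in A)%:R * survival (2 * w / (v x + w)) f #|A|.
Proof.
elim: f A => [|m f IHf] A /=.
  case=> _ /= cA _; rewrite mulr1; congr (_%:R); congr nat_of_bool.
  apply/eqP/idP => [->|xA]; first by rewrite set11.
  apply/eqP; rewrite eq_sym eqEcard sub1set xA cards1.
  by move: cA; case: #|A| => // n; lia.
move=> fmt; have [m0 mA fmt'] := format_cons fmt.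
apply: round_survival => // C cC; rewrite IHf ?cC //.
Qed.

(** * The balanced format *)

(** The rounds of the balanced format once the number of players is a power of
    two, in a form that unfolds round by round. *)
Fixpoint halving (s : nat) : seq nat :=
  if s is s'.+1 then (2 ^ s')%N :: halving s' else [::].

Lemma balancedE s k :
  balanced s k = if k == 0%N then halving s else k :: halving s.
Proof.
have -> : halving s = rev [seq (2 ^ i)%N | i <- iota 0 s].
  elim: s => // s IHs; rewrite -(addn1 s) iotaD addn1 map_cat rev_cat /= add0n.
  by rewrite -IHs.
by rewrite /balanced; case: eqP.
Qed.

Lemma is_format_cons n m f : (0 < m)%N -> (2 * m <= n)%N ->
  is_format (n - m) f -> is_format n (m :: f).
Proof.
move=> m0 mn [pos sumE le2]; split=> [[|s] //= /pos //||[|s] /=].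
- by move: sumE => /=; lia.
- by rewrite subn0.
- by move=> /le2; rewrite subnDA.
Qed.

Lemma is_format_halving s : is_format (2 ^ s) (halving s).
Proof.
elim: s => [|s IHs] /=; first by split.
apply: is_format_cons; rewrite ?expn_gt0 // ?expnS //.
by rewrite mul2n -addnn addnK.
Qed.

Lemma is_format_balanced s k : (k <= 2 ^ s)%N ->
  is_format (2 ^ s + k) (balanced s k).
Proof.
move=> ks; rewrite balancedE; case: (posnP k) => [->|k0].
  by rewrite addn0; apply: is_format_halving.
apply: is_format_cons => //; first by lia.
by rewrite addnK; apply: is_format_halving.
Qed.

(** * Optimality *)

Section Optimal.
Variables (R : realFieldType) (c : R).
Hypotheses (c_ge0 : 0 <= c) (c_le1 : c <= 1).

Lemma survival_halving s : survival c (halving s) (2 ^ s) = (1 - c / 2) ^+ s.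
Proof.
elim: s => [|s IHs] //=.
have -> : (2 ^ s.+1 - 2 ^ s = 2 ^ s)%N by rewrite expnS mul2n -addnn addnK.
rewrite IHs exprS expnS natrM; congr (_ * _).
have N0 : ((2 ^ s)%:R : R) != 0 by rewrite pnatr_eq0 expn_eq0.
by field.
Qed.

Definition balanced_survival s k : R :=
  (1 - c / 2) ^+ s * (1 - c * k%:R / (2 ^ s + k)%:R).

Lemma survival_balanced s k :
  survival c (balanced s k) (2 ^ s + k) = balanced_survival s k.
Proof.
rewrite /balanced_survival balancedE; case: (posnP k) => [->|k0] /=.
  by rewrite addn0 survival_halving mulr0 mul0r subr0 mulr1.
by rewrite addnK survival_halving mulrC.
Qed.

(** A first round of m matches that leaves N + j >= N players, with N = 2^s: the
    balanced format would play the j + m matches of both rounds at once, and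
    the common factor (1 - c/2)^s is removed. *)
Lemma round_same_level (N j m : R) : 0 < N -> 0 <= j -> 0 <= m ->
  (1 - c * m / (N + j + m)) * (1 - c * j / (N + j))
    <= 1 - c * (j + m) / (N + j + m).
Proof.
move=> N0 j0 m0; rewrite -subr_ge0.
have r0 : N + j != 0 by rewrite gt_eqF // ltr_wpDr.
have n0 : N + j + m != 0 by rewrite gt_eqF // !ltr_wpDr.
rewrite (_ : _ - _ =
  c * (1 - c) * m * j / ((N + j + m) * (N + j))); last by field; rewrite n0 r0.
by rewrite divr_ge0 // !(subr_ge0, mulr_ge0, addr_ge0) // ?ltW.
Qed.

(** A first round leaving N + j <= 2 N players out of 2 N + l, with N = 2^(s-1):
    the balanced format passes through exactly 2 N players instead.  The bound
    l <= 2 j says that the first round has at most as many matches as pairs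
    can be formed; the common factor (1 - c/2)^(s-1) is removed. *)
Lemma round_next_level (N j l : R) : 0 < N -> 0 <= j <= N -> 0 <= l <= 2 * j ->
  (1 - c * (N + l - j) / (2 * N + l)) * (1 - c * j / (N + j))
    <= (1 - c / 2) * (1 - c * l / (2 * N + l)).
Proof.
move=> N0 /andP[j0 jN] /andP[l0 lj]; rewrite -subr_ge0.
have r0 : N + j != 0 by rewrite gt_eqF // ltr_wpDr.
have n0 : 2 * N + l != 0 by rewrite gt_eqF // ltr_wpDr // mulr_gt0.
rewrite (_ : _ - _ =
  c * (1 - c) * (2 * j - l) * (N - j) / (2 * (2 * N + l) * (N + j)));
  last by field; rewrite n0 r0.
by rewrite divr_ge0 // !(subr_ge0, mulr_ge0, addr_ge0) // ?ltW.
Qed.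

(** Induction on the format: the rounds after the first may be replaced by the
    balanced format for the remaining players, and then the first two steps
    are compared by one of the two inequalities above. *)
Lemma survival_le_balanced f s k : (k < 2 ^ s)%N ->
  is_format (2 ^ s + k) f ->
  survival c f (2 ^ s + k) <= balanced_survival s k.
Proof.
have p_ge0 t : 0 <= (1 - c / 2) ^+ t :> R.
  by apply: exprn_ge0; have := c_ge0; have := c_le1; lra.
elim: f s k => [|m f IHf] s k ks fmt.
  have [_ /= nE _] := fmt.
  have s0 : (0 < 2 ^ s)%N by rewrite expn_gt0.
  have [k0 s1] : k = 0%N /\ (2 ^ s = 1)%N by lia.
  rewrite /balanced_survival k0 mulr0 mul0r subr0 mulr1.
  by case: s s1 {ks fmt nE s0} => // s; rewrite expnS; lia.
have [m0 mn fmt'] := format_cons fmt.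
have N0 t : 0 < (2 ^ t)%:R :> R by rewrite ltr0n expn_gt0.
have coef_ge0 : 0 <= 1 - c * m%:R / (2 ^ s + k)%:R.
  have n0 : 0 < (2 ^ s + k)%:R :> R by rewrite ltr0n; lia.
  rewrite subr_ge0 ler_pdivrMr // mul1r.
  apply: (@le_trans _ _ m%:R); last by rewrite ler_nat; lia.
  by rewrite ler_piMl.
(* At least 2^s players remain exactly when m <= k. *)
have [km|mk] := leqP m k.
  pose j := (k - m)%N; have kE : k = (j + m)%N by rewrite subnK.
  have rE : (2 ^ s + k - m = 2 ^ s + j)%N by lia.
  rewrite rE in fmt'; rewrite /= rE.
  have jN : (j < 2 ^ s)%N by lia.
  apply: le_trans (ler_wpM2l coef_ge0 (IHf _ _ jN fmt')) _.
  rewrite /balanced_survival mulrCA; apply: ler_wpM2l => //.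
  by rewrite kE addnA !natrD; apply: round_same_level; rewrite ?N0 ?ler0n.
case: s ks fmt mn fmt' coef_ge0 => [|s] ks fmt mn fmt' coef_ge0.
  by rewrite expn0 in ks mn; lia.
rewrite expnS in ks mn fmt' coef_ge0 *.
pose j := (2 ^ s + k - m)%N.
have rE : (2 * 2 ^ s + k - m = 2 ^ s + j)%N by lia.
have jN : (j < 2 ^ s)%N by lia.
rewrite rE in fmt'; rewrite /= rE.
apply: le_trans (ler_wpM2l coef_ge0 (IHf _ _ jN fmt')) _.
rewrite /balanced_survival exprSr -[X in _ <= X]mulrA [X in X <= _]mulrCA.
apply: ler_wpM2l => //.
have mE : m%:R = (2 ^ s)%:R + k%:R - j%:R :> R.
  by rewrite -natrD -natrB; [congr (_%:R); lia | lia].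
rewrite expnS !(natrD _ (2 * 2 ^ s)) (natrD _ _ j) natrM mE.
apply: round_next_level => //.
  by rewrite ler0n ler_nat ltnW.
by rewrite ler0n -natrM ler_nat; lia.
Qed.

End Optimal.

Theorem theorem4 (R : realFieldType) (n : nat) (hn : (2 <= n)%N)
    (v : 'I_n -> R) (w : R)
    (hw : 0 < w)
    (hv1 : w < v (player1 hn))
    (hv : forall i : 'I_n, i != player1 hn -> v i = w)
    (s k : nat) (hs : (1 <= s)%N) (hk : (k < 2 ^ s)%N)
    (hnk : n = (2 ^ s + k)%N) :
  is_format n (balanced s k) /\
  forall f : seq nat, is_format n f ->
    win_prob v f (player1 hn) <= win_prob v (balanced s k) (player1 hn).
Proof.
have v_gt0 i : 0 < v i.
  by case: (eqVneq i (player1 hn)) => [->|/hv -> //]; apply: lt_trans hv1.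
have bal : is_format n (balanced s k).
  by rewrite hnk; apply: is_format_balanced; apply: ltnW.
set c := 2 * w / (v (player1 hn) + w).
have winE f : is_format n f -> win_prob v f (player1 hn) = survival c f n.
  move=> fmt; rewrite /win_prob (alive_prob_survival v_gt0 hw hv).
    by rewrite inE mul1r cardsT card_ord.
  by rewrite cardsT card_ord.
split=> // f fmt; rewrite !winE //.
have vw_gt0 : 0 < v (player1 hn) + w by rewrite addr_gt0.
have c_ge0 : 0 <= c by rewrite divr_ge0 ?mulr_ge0 ?ltW.
have c_le1 : c <= 1 by rewrite ler_pdivrMr //; lra.
rewrite {2}hnk survival_balanced; rewrite hnk in fmt *.
exact: survival_le_balanced.
Qed.
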